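(* Let $S=T\circ T\circ T$ be the third iterate of the Collatz map $T:\mathbb{N}\to\mathbb{N}$. For $k\in\mathbb{N}$ let $$q^{(k)}_{ij}:=\frac{\mu_{inv}\left[\mathcal{B}(i,8)\cap S^{\circ -k}\mathcal{B}(j,8)\right]}{\mu_{inv}\left[\mathcal{B}(i,8)\right]}\qquad (i,j=0,\dots,7),$$ and let $q^*$ be the $8\times 8$ matrix, with rows and columns indexed by $0,\dots,7$, with entries $$q^*_{ij}:=\frac{\mu_{inv}\left[\mathcal{B}(i,8)\cap S^{-1}\mathcal{B}(j,8)\right]}{\mu_{inv}\left[\mathcal{B}(i,8)\right]}\qquad (i,j=0,\dots,7).$$ Then for every $k\in\mathbb{N}$, $$q^{(k)}_{ij}=[(q^* )^k]_{ij}\qquad (i,j=0,\dots,7).$$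
   Context: $\mathbb{N}$ denotes the positive integers. The Collatz map $T:\mathbb{N}\to\mathbb{N}$ is $T(n)=n/2$ if $n$ is even and $T(n)=3n+1$ if $n$ is odd. For $m\ge1$ and $i\in\{0,\dots,8^m-1\}$, $\mathcal{B}(i,8^m)=\{n\in\mathbb{N}:\exists k\in\mathbb{N}\cup\{0\},\ n=i+8^mk\}$. $S^{\circ -k}A=\{n\in\mathbb{N}:S^{\circ k}(n)\in A\}$ is the preimage under the $k$-fold composition $S^{\circ k}$, and $S^{-1}A=S^{\circ -1}A$. $\mu_{inv}$ is the finitely additive set function, defined on finite unions of classes $\mathcal{B}(i,8^m)$ ($m\ge 1$, $0\le i\le 8^m-1$), determined by $$\mu_{inv}(\mathcal{B}(i,8^m))=\frac{\nu(i)}{8^{m-1}},\qquad \nu(i)=\tfrac16 \text{ if } i \text{ is even},\quad \nu(i)=\tfrac1{12}\text{ if } i\text{ is odd}.$$ The sets $S^{\circ -k}\mathcal{B}(j,8)$ are finite unions of classes modulo $8^{k+1}$, so all the $\mu_{inv}$-values above are defined. $(q^* )^k$ is the $k$-th matrix power. *)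

(* Defs.v *)
From HB Require Import structures.
From mathcomp Require Import all_boot all_order all_algebra.
From mathcomp Require Import mathcomp_extra boolp classical_sets reals.

Set Implicit Arguments.
Unset Strict Implicit.
Unset Printing Implicit Defensive.

Import Order.TTheory GRing.Theory Num.Theory.

Local Open Scope classical_set_scope.
Local Open Scope ring_scope.

(* The ambient space is the set of positive integers, encoded as the n : nat  *)
(* with 0 < n; [residue_class] and [preimS] only contain such n.              *)

Definition collatz (n : nat) : nat := if odd n then (3 * n + 1)%N else n./2.

Definition collatz3 : nat -> nat := collatz \o collatz \o collatz.

Definition residue_class (i M : nat) : set nat :=
  [set n : nat | (0 < n)%N /\ exists k : nat, n = (i + M * k)%N].

Definition preimS (k : nat) (A : set nat) : set nat :=
  [set n : nat | (0 < n)%N /\ A (iter k collatz3 n)].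

(* An entry p of s stands for the class of p.2 modulo 8 ^ p.1; the empty      *)
(* union is included.                                                         *)
Definition residue_union (A : set nat) : Prop :=
  exists2 s : seq (nat * nat),
    forall p, p \in s -> (0 < p.1)%N /\ (p.2 < 8 ^ p.1)%N &
    A = \bigcup_(p in [set` s]) residue_class p.2 (8 ^ p.1).

Definition finitely_additive (R : realType) (mu : set nat -> R) : Prop :=
  forall A B : set nat, residue_union A -> residue_union B ->
    A `&` B = set0 -> mu (A `|` B) = mu A + mu B.

Definition nu (R : realType) (i : nat) : R :=
  if odd i then 12%:R^-1 else 6%:R^-1.

(* This constrains mu only on the sets satisfying [residue_union]; there it   *)
(* determines mu, see [mu_inv_exists] and [mu_inv_unique].                    *)
Definition is_mu_inv (R : realType) (mu : set nat -> R) : Prop :=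
  finitely_additive mu /\
  forall m i : nat, (0 < m)%N -> (i < 8 ^ m)%N ->
    mu (residue_class i (8 ^ m)) = nu R i / 8%:R ^+ (m - 1).

Definition qk (R : realType) (mu : set nat -> R) (k : nat) : 'M[R]_8 :=
  \matrix_(i < 8, j < 8)
    (mu (residue_class i 8 `&` preimS k (residue_class j 8))
     / mu (residue_class i 8)).

Definition qstar (R : realType) (mu : set nat -> R) : 'M[R]_8 :=
  \matrix_(i < 8, j < 8)
    (mu (residue_class i 8 `&` preimS 1 (residue_class j 8))
     / mu (residue_class i 8)).

(* A set of positive integers that is a union of classes modulo 8 ^ m.        *)
Definition level (m : nat) (A : set nat) : Prop :=
  (forall n, A n -> (0 < n)%N) /\
  (forall n n' : nat, (0 < n')%N -> n = n' %[mod 8 ^ m] -> A n -> A n').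

Lemma residue_classP i m n : (i < 8 ^ m)%N ->
  residue_class i (8 ^ m) n <-> (0 < n)%N /\ (n %% 8 ^ m = i)%N.
Proof.
move=> im; split=> [[n0 [k nE]]|[n0 ni]]; split=> //.
- by rewrite nE mulnC addnC modnMDl modn_small.
- by exists (n %/ 8 ^ m)%N; rewrite -ni addnC mulnC -divn_eq.
Qed.

Lemma level_le m m' A : (m <= m')%N -> level m A -> level m' A.
Proof.
move=> mm' [A0 Am]; split=> // n n' n'0 nn'; apply: Am => //.
have d : (8 ^ m %| 8 ^ m')%N by apply: dvdn_exp2l.
by rewrite -(modn_dvdm n d) nn' modn_dvdm.
Qed.

Lemma residue_union_level A : residue_union A -> exists2 m, (0 < m)%N & level m A.
Proof.
case=> s sP ->; exists (\max_(p <- s) p.1).+1 => //; split=> [n [p _ []]//|].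
move=> n n' n'0 nn' [p ps pn]; exists p => //.
have [p1 p2] := sP p ps; apply/residue_classP => //.
have /residue_classP -/(_ p2) [_ <-] := pn; split=> //.
have d : (8 ^ p.1 %| 8 ^ (\max_(p <- s) p.1).+1)%N.
  by apply: dvdn_exp2l; apply: leqW; apply: leq_bigmax_seq.
by rewrite -(modn_dvdm n d) nn' modn_dvdm.
Qed.

Lemma residue_union_class m i : (0 < m)%N -> (i < 8 ^ m)%N ->
  residue_union (residue_class i (8 ^ m)).
Proof.
move=> m0 im; exists [:: (m, i)] => [p|]; first by rewrite inE => /eqP ->.
apply/seteqP; split=> [n ni|n [p /=]]; first by exists (m, i); rewrite /= ?inE.
by rewrite inE => /eqP ->.
Qed.

Lemma residue_unionU A B :
  residue_union A -> residue_union B -> residue_union (A `|` B).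
Proof.
case=> s sP -> [t tP ->]; exists (s ++ t) => [p|].
  by rewrite mem_cat => /orP[/sP|/tP].
apply/seteqP; split=> [n [[p ps pn]|[p pt pn]]|n [p /=]].
- by exists p => //=; rewrite mem_cat ps.
- by exists p => //=; rewrite mem_cat pt orbT.
- by rewrite mem_cat => /orP[ps|pt] pn; [left|right]; exists p.
Qed.

Lemma level_repr m i (A : set nat) n : level m A -> (0 < n)%N ->
  (n %% 8 ^ m = i %% 8 ^ m)%N -> A (i + 8 ^ m)%N <-> A n.
Proof.
move=> [A0 Am] n0 ni; split; apply: Am => //; rewrite ?addn_gt0 ?expn_gt0 ?orbT //.
  by rewrite modnDr.
by rewrite modnDr.
Qed.

(* i + 8 ^ m is a representative of the class of i that is positive even for  *)
(* i = 0.                                                                     *)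
Definition level_sum (R : realType) (m : nat) (A : set nat) : R :=
  \sum_(i < 8 ^ m) (if `[< A (i + 8 ^ m)%N >] then nu R i / 8%:R ^+ (m - 1) else 0).

Lemma level_sumS (R : realType) m A : (0 < m)%N -> level m A ->
  level_sum R m.+1 A = level_sum R m A.
Proof.
move=> m0 Am; rewrite /level_sum subn1 /=.
rewrite -(big_mkord xpredT (fun i => if `[< A (i + 8 ^ m.+1)%N >]
   then nu R i / 8%:R ^+ m else 0)).
rewrite -(big_mkord xpredT (fun i => if `[< A (i + 8 ^ m)%N >]
   then nu R i / 8%:R ^+ (m - 1) else 0)).
rewrite {1}expnS big_nat_mul big_mkord.
rewrite (eq_bigr (fun=> \sum_(0 <= i < 8 ^ m)
    if `[< A (i + 8 ^ m)%N >] then nu R i / 8%:R ^+ m else 0)); last first.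
  move=> t _; rewrite -[X in index_iota X _]add0n big_addn mulSn addnK.
  apply: eq_bigr => i _; congr (if _ then _ / _ else _).
    apply: asbool_equiv_eq; apply: iff_sym; apply: level_repr => //.
      by rewrite addn_gt0 expn_gt0 orbT.
    by rewrite expnS -addnA -mulnDl addnC modnMDl.
  by rewrite /nu oddD oddM oddX (gtn_eqF m0) andbF addbF.
rewrite sumr_const card_ord -sumrMnl; apply: eq_bigr => i _.
case: ifP => _; last by rewrite mul0rn.
case: m m0 {Am} => // m _; rewrite subn1 /= exprS invfM -[LHS]mulr_natl mulrCA.
by rewrite mulVKf // pnatr_eq0.
Qed.

Lemma level_sum_eq (R : realType) m m' A :
  (0 < m)%N -> (0 < m')%N -> level m A -> level m' A ->
  level_sum R m A = level_sum R m' A.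
Proof.
wlog mm' : m m' / (m <= m')%N => [W m0 m'0 Am Am'|m0 _ Am _].
  by case/orP: (leq_total m m') => ?; [|symmetry]; apply: W.
rewrite -(subnKC mm'); elim: (m' - m)%N => [|d ->]; first by rewrite addn0.
rewrite addnS level_sumS ?addn_gt0 ?m0 //.
by apply: level_le Am; rewrite leq_addr.
Qed.

Lemma mu_inv_exists (R : realType) : exists mu : set nat -> R, is_mu_inv mu.
Proof.
pose mu A : R := level_sum R (xget 0%N [set m | (0 < m)%N /\ level m A]) A.
have muE m A : (0 < m)%N -> level m A -> mu A = level_sum R m A.
  move=> m0 Am; rewrite /mu; case: xgetP => [m' _ [m'0 Am']|/(_ m)[]//].
  exact: level_sum_eq.
exists mu; split=> [A B uA uB AB|m i m0 im].
  have [a a0 Aa] := residue_union_level uA.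
  have [b b0 Bb] := residue_union_level uB.
  pose m := maxn a b; have m0 : (0 < m)%N by rewrite leq_max a0.
  have Am : level m A by apply: level_le Aa; rewrite leq_maxl.
  have Bm : level m B by apply: level_le Bb; rewrite leq_maxr.
  have ABm : level m (A `|` B).
    case: Am Bm => A0 Am [B0 Bm]; split=> [n [/A0|/B0]//|n n' n'0 nn'].
    by case=> [/(Am _ _ n'0 nn')|/(Bm _ _ n'0 nn')]; [left|right].
  rewrite !(muE m) // -big_split; apply: eq_bigr => i _ /=.
  case: asboolP => ABi; case: asboolP => Ai; case: asboolP => Bi;
    rewrite ?addr0 ?add0r //.
  - by have : (A `&` B) (i + 8 ^ m)%N by []; rewrite AB.
  - by case: ABi.
  - by case: ABi; left.
  - by case: ABi; left.
  - by case: ABi; right.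
have [m' _ Bm'] := residue_union_level (residue_union_class m0 im).
have Bm : level m (residue_class i (8 ^ m)).
  split=> [n []//|n n' n'0 nn' /(residue_classP _ im)[n0 ni]].
  by apply/residue_classP => //; rewrite -nn'.
rewrite (muE m) // /level_sum (bigD1 (Ordinal im)) //= big1 ?addr0 => [|j ji].
  rewrite asboolT //; apply/residue_classP => //.
  by rewrite addn_gt0 expn_gt0 orbT modnDr modn_small.
rewrite asboolF // => /(residue_classP _ im)[_].
by rewrite modnDr modn_small // => /eqP; rewrite (negbTE (_ : val j != i)).
Qed.

Lemma mu_inv_unique (R : realType) (mu1 mu2 : set nat -> R) A :
  is_mu_inv mu1 -> is_mu_inv mu2 -> residue_union A -> mu1 A = mu2 A.
Proof.
move=> [add1 mu1E] [add2 mu2E] /residue_union_level[m m0 Am].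
pose F (s : seq nat) := [set n | A n /\ (n %% 8 ^ m)%N \in s].
suff H s : uniq s -> all (fun i => i < 8 ^ m)%N s ->
    residue_union (F s) /\ mu1 (F s) = mu2 (F s).
  have [|_] := H (iota 0 (8 ^ m)) (iota_uniq _ _).
    by apply/allP => i; rewrite mem_iota.
  suff -> : F (iota 0 (8 ^ m)) = A by [].
  apply/seteqP; split=> [n []//|n An]; split=> //.
  by rewrite mem_iota ltn_mod expn_gt0.
elim: s => [_ _|i s IH /= /andP[is_ us] /andP[im sm]].
  have -> : F [::] = set0 by apply/seteqP; split=> n // [].
  have u0 : residue_union set0.
    by exists [::] => //; apply/seteqP; split=> n // [].
  split=> //; have := add1 _ _ u0 u0 (setI0 _); have := add2 _ _ u0 u0 (setI0 _).
  by rewrite setU0 => /eqP; rewrite -subr_eq subrr => /eqP <- /eqP;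
    rewrite -subr_eq subrr => /eqP <-.
have [us' Es] := IH us sm; have ui := residue_union_class m0 im.
have [Ai|Ai] := pselect (A (i + 8 ^ m)%N).
  have -> : F (i :: s) = residue_class i (8 ^ m) `|` F s.
    apply/seteqP; split=> n.
      case=> An; rewrite inE => /orP[/eqP ni|ns]; last by right.
      by left; apply/residue_classP => //; split=> //; apply: Am.1.
    case=> [/(residue_classP _ im)[n0 ni]|[An ns]]; split=> //.
    - by apply: (iffLR (level_repr Am n0 _) Ai); rewrite ni modn_small.
    - by rewrite inE ni eqxx.
    - by rewrite inE ns orbT.
  have d : residue_class i (8 ^ m) `&` F s = set0.
    apply/seteqP; split=> n // [/(residue_classP _ im)[_ ni] [_]].
    by rewrite ni (negbTE is_).
  split; first exact: residue_unionU.
  by rewrite add1 // add2 // mu1E // mu2E // Es.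
suff -> : F (i :: s) = F s by [].
apply/seteqP; split=> n [An ns]; last by split=> //; rewrite inE ns orbT.
split=> //; move: ns; rewrite inE => /orP[/eqP ni|//].
by case: Ai; apply: (iffRL (level_repr Am (Am.1 _ An) _) An); rewrite ni modn_small.
Qed.

(* Main.v *)
Require Import Defs.
From mathcomp Require Import all_boot all_order all_algebra.
From mathcomp Require Import boolp classical_sets reals.
From mathcomp Require Import zify ring.

(** The residues modulo 8 of n, S n, S (S n), ... form a Markov chain under the
    invariant measure, and the theorem is the Chapman-Kolmogorov equation of
    this chain. What has to be seen is the loss of memory.

    The measure conditioned on a class modulo 8 is uniform: with n = i + 8 t,
    the quotient t is equidistributed modulo every power of 8. On such a class
    S is affine in t. An odd step of T multiplies the slope by 3 and an even
    step halves it, so three steps with a odd ones turn the slope 8 into 6 ^ a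
    ([collatz3_affine]). The congruence S i + 6 ^ a * t = c modulo 8 ^ m has
    2 ^ a solutions t when S i and c agree modulo 2 ^ a and none otherwise
    ([count_linear_congruence]). As a <= 3, the modulus 2 ^ a divides 8, so this
    number depends only on c modulo 8 and not on m: given the classes of n and
    of S n modulo 8, the point S n is again uniform inside its class
    ([mu_transition_class]).

    A finitely additive function is determined by its values on classes
    ([finitely_additive_level]), so this extends from classes to all their
    finite unions A ([mu_markov]): given the class l of S n, the event that S n
    lies in A has the probability that A has in the class l, whatever the class
    of n is. Taking for A the preimage of a class under the k-th iterate of S
    gives q^(k+1) = q* q^(k), and the theorem follows by induction on k. *)

Import GRing.Theory Num.Theory.

Local Open Scope classical_set_scope.
Local Open Scope ring_scope.

(** * Finitely additive functions on unions of residue classes *)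

(** With [residue_union_level], this makes [level] a criterion for membership
    in the domain of the measure; unlike explicit unions of classes, levels are
    easily followed through intersections and preimages. *)
Lemma level_residue_union {m A} : (0 < m)%N -> level m A -> residue_union A.
Proof.
move=> m0 Am.
exists [seq (m, r) | r <- iota 0 (8 ^ m) & `[< A (r + 8 ^ m)%N >]].
  move=> _ /mapP[r + ->] /=; rewrite mem_filter mem_iota => /andP[_ /andP[_]].
  by split.
apply/seteqP; split=> [n An|n [_ /mapP[r + ->] /=]].
  have n0 := Am.1 _ An.
  exists (m, n %% 8 ^ m)%N => /=; last first.
    by apply/residue_classP; rewrite ?ltn_mod ?expn_gt0.
  apply/map_f; rewrite mem_filter mem_iota /= add0n ltn_mod expn_gt0 andbT.
  by apply/asboolP/(iffRL (level_repr Am n0 _) An); rewrite modn_mod.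
rewrite mem_filter mem_iota => /andP[/asboolP Ar /andP[_ rm]].
move=> /(residue_classP _ rm)[n0 nr].
by apply: (iffLR (level_repr Am n0 _) Ar); rewrite nr modn_small.
Qed.

Lemma level_residue_class {m r} : (r < 8 ^ m)%N -> level m (residue_class r (8 ^ m)).
Proof.
move=> rm; split=> [n []//|n n' n'0 nn' /(residue_classP _ rm)[_ nr]].
by apply/residue_classP => //; rewrite -nn'.
Qed.

Lemma residue_class8P (i : 'I_8) n :
  residue_class i 8 n <-> (0 < n)%N /\ (n %% 8 = i)%N.
Proof. exact: (@residue_classP i 1 n (ltn_ord i)). Qed.

Lemma level_residue_class8 (i : 'I_8) : level 1 (residue_class i 8).
Proof. exact: (@level_residue_class 1 i (ltn_ord i)). Qed.

Lemma levelI {m A B} : level m A -> level m B -> level m (A `&` B).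
Proof.
move=> [A0 Am] [B0 Bm]; split=> [n [/A0]//|n n' n'0 nn' [An Bn]].
by split; [apply: Am nn' An|apply: Bm nn' Bn].
Qed.

Lemma finitely_additive_set0 {R : realType} {f : set nat -> R} :
  finitely_additive f -> f set0 = 0.
Proof.
move=> fadd; have u0 : residue_union set0.
  by exists [::] => //; apply/seteqP; split=> n // [].
have /eqP := fadd _ _ u0 u0 (setI0 _).
by rewrite setU0 -subr_eq subrr eq_sym => /eqP.
Qed.

(** The residues modulo 8 ^ m are added one at a time: the part of A whose
    residues are below b grows by a whole class, or not at all, when b
    increases. *)
Lemma finitely_additive_level {R : realType} {f : set nat -> R} {m A} :
  finitely_additive f -> (0 < m)%N -> level m A ->
  f A = \sum_(r < 8 ^ m | `[< A (r + 8 ^ m)%N >]) f (residue_class r (8 ^ m)).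
Proof.
move=> fadd m0 Am.
pose F b := A `&` [set n | (n %% 8 ^ m < b)%N].
have Fm b : level m (F b).
  split=> [n [/(Am.1)]//|n n' n'0 nn' [An nb]].
  by split; [apply: Am.2 nn' An|rewrite /= -nn'].
suff FE b : (b <= 8 ^ m)%N -> f (F b) =
    \sum_(0 <= r < b | `[< A (r + 8 ^ m)%N >]) f (residue_class r (8 ^ m)).
  rewrite -(big_mkord (fun r => `[< A (r + 8 ^ m)%N >])
    (fun r => f (residue_class r (8 ^ m)))) -FE //; congr f.
  by apply/seteqP; split=> [n An|n []//]; split=> //=; rewrite ltn_mod expn_gt0.
elim: b => [_|b IH bm].
  rewrite big_geq // -(finitely_additive_set0 fadd); congr f.
  by apply/seteqP; split=> n // [].
rewrite big_mkcond big_nat_recr //= -big_mkcond -IH ?(ltnW bm) //.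
case: asboolP => Ab.
  rewrite -fadd; first congr f.
  - apply/seteqP; split=> [n [An]|n].
      rewrite /= ltnS leq_eqVlt => /orP[/eqP nb|nb]; last by left; split.
      by right; apply/residue_classP => //; split=> //; apply: Am.1.
    case=> [[An nb]|/(residue_classP _ bm)[n0 nb]].
      by split=> //=; apply: leqW.
    split; last by rewrite /= nb.
    by apply: (iffLR (level_repr Am n0 _) Ab); rewrite nb modn_small.
  - exact: level_residue_union m0 (Fm b).
  - exact: residue_union_class.
  apply/seteqP; split=> n // [[_ /= nb] /(residue_classP _ bm)[_ nE]].
  by rewrite nE ltnn in nb.
rewrite addr0; congr f; apply/seteqP; split=> n [An nb]; split=> //; last exact: leqW.
move: nb; rewrite /= ltnS leq_eqVlt => /orP[/eqP nb|//].
by case: Ab; apply: (iffRL (level_repr Am (Am.1 _ An) _) An); rewrite nb modn_small.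
Qed.

(** * The third iterate of the Collatz map on a class modulo 8 *)

Lemma collatz_gt0 n : (0 < n)%N -> (0 < collatz n)%N.
Proof. by rewrite /collatz; case: ifP => no; lia. Qed.

Lemma collatz3_gt0 n : (0 < n)%N -> (0 < collatz3 n)%N.
Proof. by move=> n0; do 3 apply: collatz_gt0. Qed.

(** An odd step turns the slope 2 c into 6 c, an even step into c. As 6 c is
    even, each odd step gains a factor 2 that the next step can use, and writing
    the factor as 6 ^ odd b treats both parities at once. *)
Lemma collatz_affine b c t :
  collatz (b + 2 * c * t) = (collatz b + 6 ^ odd b * c * t)%N.
Proof.
rewrite /collatz oddD -mulnA mul2n odd_double addbF.
case: (odd b); rewrite ?expn1 ?expn0; first by rewrite -mul2n; ring.
by rewrite halfD odd_double andbF doubleK add0n mul1n.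
Qed.

(** The slope 8 carries three factors 2, which is exactly what three steps
    consume; the exponent a is the number of odd steps. *)
Lemma collatz3_affine i : exists2 a, (a <= 3)%N &
  forall t, collatz3 (i + 8 * t) = (collatz3 i + 6 ^ a * t)%N.
Proof.
exists (odd i + odd (collatz i) + odd (collatz (collatz i)))%N => [|t].
  by do 3 case: (odd _).
have step b c d : d = (2 * c)%N ->
    collatz (b + d * t) = (collatz b + 6 ^ odd b * c * t)%N.
  by move=> ->; apply: collatz_affine.
rewrite /collatz3 /= (step _ 4%N) // (step _ (6 ^ odd i * 2)%N); last by lia.
rewrite (step _ (6 ^ odd (collatz i) * 6 ^ odd i)%N); last by lia.
by rewrite !expnD; lia.
Qed.

(** Writing n = i + 8 t, the residue of n modulo 8 ^ m.+1 determines i and t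
    modulo 8 ^ m, hence S n modulo 8 ^ m because S n is affine in t. *)
Lemma level_preimS1 {m A} : level m A -> level m.+1 (preimS 1 A).
Proof.
move=> [_ Am]; split=> [n []//|n n' n'0 nn' [n0 An]]; split=> //.
have E8 : (n %% 8 = n' %% 8)%N.
  have d : (8 %| 8 ^ m.+1)%N by rewrite expnS dvdn_mulr.
  by rewrite -(modn_dvdm n d) nn' modn_dvdm.
apply: Am An; first exact: collatz3_gt0.
have nE x : x = (x %% 8 + 8 * (x %/ 8))%N by rewrite addnC mulnC -divn_eq.
rewrite /= (nE n) (nE n') E8.
have [a _ aE] := collatz3_affine (n' %% 8).
rewrite !aE; apply/eqP; rewrite eqn_modDl -modnMmr -[eqbRHS]modnMmr.
by rewrite !modn_divl -expnSr nn'.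
Qed.

Lemma preimSS k A : preimS k.+1 A = preimS 1 (preimS k A).
Proof.
apply/seteqP; split=> n; rewrite /preimS /= -iterS iterSr; last by case=> n0 [].
by case=> n0 An; do !split=> //; apply: collatz3_gt0.
Qed.

Lemma level_preimS k {m A} : level m A -> level (m + k) (preimS k A).
Proof.
move=> Am; elim: k => [|k IH]; last first.
  by rewrite addnS preimSS; apply: level_preimS1.
rewrite addn0 (_ : preimS 0 A = A) //.
by apply/seteqP; split=> n; [case|move=> An; split=> //; apply: Am.1].
Qed.

Lemma preimSU k A B : preimS k (A `|` B) = preimS k A `|` preimS k B.
Proof.
apply/seteqP; split=> n; first by case=> n0 [?|?]; [left|right].
by case=> -[n0 ?]; split=> //; [left|right].
Qed.

(** * Counting solutions of linear congruences *)

Lemma count_linear_congruence_coprime {u N} c : (0 < N)%N -> coprime u N ->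
  (\sum_(t < N) (u * t == c %[mod N]) = 1)%N.
Proof.
move=> N0 uN.
pose h (t : 'I_N) : 'I_N := Ordinal (ltn_pmod (u * t) N0).
have hinj : injective h.
  move=> t t' /(congr1 val) /= /eqP tt'; apply/val_inj => /=.
  rewrite -(modn_small (ltn_ord t)) -(modn_small (ltn_ord t')); apply/eqP.
  wlog le : t t' tt' / (t' <= t)%N.
    move=> W; case/orP: (leq_total t' t) => le; first exact: W.
    by rewrite eq_sym; apply: W => //; rewrite eq_sym.
  rewrite eqn_mod_dvd ?leq_mul // -mulnBr Gauss_dvdr 1?coprime_sym // in tt'.
  by rewrite eqn_mod_dvd.
(* An injective self-map of a finite set is onto. *)
have [t0 t0E] : exists t0, h t0 = Ordinal (ltn_pmod c N0).
  by have [g _ gK] := injF_bij hinj; exists (g (Ordinal (ltn_pmod c N0))).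
rewrite (bigD1 t0) //= big1 => [|t tt0].
  by rewrite (congr1 val t0E : u * t0 %% N = c %% N)%N eqxx.
apply/eqP; rewrite eqb0; apply: contra tt0 => /eqP ut.
by apply/eqP/hinj/val_inj; rewrite t0E.
Qed.

(** Here g plays the role of the gcd of the modulus and of the slope. When g
    divides c - s, dividing by g leaves a congruence modulo N with an invertible
    slope; it has one solution in each of the g blocks of N consecutive t. *)
Lemma count_linear_congruence {g u N s c} : (0 < g)%N -> (0 < N)%N -> coprime u N ->
  (\sum_(t < g * N) (s + g * u * t == c %[mod g * N]) =
   if s == c %[mod g] then g else 0)%N.
Proof.
move=> g0 N0 uN; have gd : (g %| g * N)%N by apply: dvdn_mulr.
case: ifPn => sc; last first.
  rewrite big1 // => t _; apply/eqP; rewrite eqb0; apply: contra sc => /eqP E.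
  rewrite -(modn_dvdm c gd) -E (modn_dvdm _ gd).
  by rewrite -mulnA [(g * _)%N]mulnC addnC modnMDl.
(* Adding the multiple g * N * s of the modulus to c keeps the difference
   c - s in the natural numbers. *)
have [c' cE] : exists c', (c + g * N * s = s + g * c')%N.
  have sc' : (s <= c + g * N * s)%N.
    by apply: leq_trans (leq_addl _ _); rewrite leq_pmull // muln_gt0 g0.
  have : (g %| c + g * N * s - s)%N.
    by rewrite -eqn_mod_dvd // -mulnA addnC mulnC modnMDl eq_sym.
  by case/dvdnP => c' E; exists c'; rewrite -(subnKC sc') E mulnC.
pose G t := (u * t == c' %[mod N] : nat).
rewrite (eq_bigr (fun t : 'I_(g * N) => G t)) => [|t _]; last first.
  have <- : (c + g * N * s = c %[mod g * N])%N by rewrite addnC mulnC modnMDl.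
  by rewrite cE eqn_modDl -mulnA -!muln_modr eqn_pmul2l.
rewrite -(big_mkord xpredT G) big_nat_mul big_mkord.
rewrite (eq_bigr (fun=> 1%N)) ?sum1_card ?card_ord // => b _.
rewrite -[X in index_iota X _]add0n big_addn mulSn addnK big_mkord.
rewrite -(count_linear_congruence_coprime c' N0 uN); apply: eq_bigr => t _.
by rewrite /G mulnDr [X in (_ + X)%N]mulnA addnC modnMDl.
Qed.

(** * The Markov property *)

Lemma nu_neq0 {R : realType} i : nu R i != 0.
Proof. by rewrite /nu; case: odd; rewrite invr_eq0 pnatr_eq0. Qed.

Section InvariantMeasure.

Context {R : realType} {mu : set nat -> R} (hmu : is_mu_inv mu).

Lemma mu_residue_class8 (i : 'I_8) : mu (residue_class i 8) = nu R i.
Proof. by have /= -> := hmu.2 1%N i isT (ltn_ord i); rewrite subnn divr1. Qed.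

(** The uniformity of the measure inside a class modulo 8: all i + 8 t have the
    parity of i, so their classes modulo 8 ^ m.+1 have equal measures, and
    measuring amounts to counting the quotients t. *)
Lemma mu_in_residue_class8 {m} {i : 'I_8} {A} : level m.+1 A ->
  mu (residue_class i 8 `&` A) =
  nu R i / 8 ^+ m * (\sum_(t < 8 ^ m) `[< A (i + 8 * t + 8 ^ m.+1)%N >])%:R.
Proof.
move=> Am; have Bm : level m.+1 (residue_class i 8).
  exact: (level_le (ltn0Sn m) (level_residue_class8 i)).
rewrite (finitely_additive_level hmu.1 (ltn0Sn m) (levelI Bm Am)).
pose G r : R := if `[< (residue_class i 8 `&` A) (r + 8 ^ m.+1)%N >]
  then nu R r / 8 ^+ m else 0.
rewrite big_mkcond (eq_bigr (fun r : 'I_(8 ^ m.+1) => G r)) => [|r _]; last first.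
  by rewrite /G hmu.2 // subn1.
(* The block of the residues 8 t, ..., 8 t + 7 meets the class of i in i + 8 t
   only. *)
rewrite -(big_mkord xpredT G) {1}expnSr big_nat_mul big_mkord natr_sum mulr_sumr.
apply: eq_bigr => t _.
rewrite -[X in index_iota X _]add0n big_addn mulSn addnK big_mkord.
have BE (r : 'I_8) : residue_class i 8 (r + t * 8 + 8 ^ m.+1)%N <-> r = i.
  have E : ((r + t * 8 + 8 ^ m.+1) %% 8 = r)%N.
    by rewrite expnSr addnAC addnC modnMDl addnC modnMDl modn_small.
  split=> [/residue_class8P[_]|<-]; first by rewrite E => /val_inj.
  apply/residue_class8P; rewrite E; split=> //.
  by rewrite addn_gt0 expn_gt0 orbT.
rewrite (bigD1 i) //= big1 => [|r ri]; last first.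
  by rewrite /G asboolF // => -[/BE/eqP]; rewrite (negbTE ri).
rewrite addr0 /G (_ : nu R (i + t * 8) = nu R i); last first.
  by rewrite /nu oddD oddM andbF addbF.
rewrite mulnC; case: asboolP => [[_ Ai]|nA]; first by rewrite asboolT // mulr1.
rewrite asboolF ?mulr0 // => Ai; apply: nA; split=> //.
by rewrite mulnC; apply/BE.
Qed.

(** The loss of memory: S carries the uniform distribution on the class of i to
    a uniform distribution on a class modulo 2 ^ a with a <= 3, and within each
    class modulo 8 the latter gives all subclasses modulo 8 ^ m the same
    weight. The function N is common to all m, which is what allows
    the comparison of m with m = 1. *)
Lemma mu_transition_class (i : 'I_8) : exists N : nat -> R,
  forall m c, (0 < m)%N -> (c < 8 ^ m)%N ->
  mu (residue_class i 8 `&` preimS 1 (residue_class c (8 ^ m))) =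
  N (c %% 8)%N / 8 ^+ m.
Proof.
have [a a3 aE] := collatz3_affine i.
exists (fun c => nu R i * (if collatz3 i == c %[mod 2 ^ a] then 2 ^ a else 0)%N%:R).
move=> m c m0 cm.
rewrite (mu_in_residue_class8 (level_preimS1 (level_residue_class cm))) mulrAC.
congr (_ * _%:R / _).
have am : (a <= 3 * m)%N by lia.
have d8 : (2 ^ a %| 8)%N by rewrite (dvdn_exp2l 2 a3).
rewrite (modn_dvdm _ d8).
have ME : (8 ^ m = 2 ^ a * 2 ^ (3 * m - a))%N by rewrite -expnD subnKC // expnM.
have cop : coprime (3 ^ a) (2 ^ (3 * m - a)) by rewrite coprimeXl // coprimeXr.
rewrite -(count_linear_congruence _ _ cop) ?expn_gt0 //.
rewrite -ME; apply: eq_bigr => t _; congr nat_of_bool.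
have n0 : (0 < i + 8 * t + 8 ^ m.+1)%N by rewrite addn_gt0 expn_gt0 orbT.
have SE : collatz3 (i + 8 * t + 8 ^ m.+1) =
    (collatz3 i + 2 ^ a * 3 ^ a * t) %[mod 8 ^ m].
  by rewrite expnS -addnA -mulnDr aE mulnDr addnA addnC modnMDl -expnMn.
rewrite -SE (modn_small cm).
apply/asboolP/eqP => [[_ /(residue_classP _ cm)[_ nc]]|nc].
  exact: nc.
by split=> //; apply/(residue_classP _ cm); split; first exact: collatz3_gt0.
Qed.

(** Both sides are finitely additive in A, so that it is enough to compare them
    on a class of c modulo 8 ^ m. There only l = c %% 8 contributes, and both
    sides are the measure for the class of l divided by 8 ^ (m - 1). *)
Lemma mu_markov (i : 'I_8) {m A} : (0 < m)%N -> level m A ->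
  mu (residue_class i 8 `&` preimS 1 A) =
  \sum_(l < 8) mu (residue_class i 8 `&` preimS 1 (residue_class l 8)) /
    mu (residue_class l 8) * mu (residue_class l 8 `&` A).
Proof.
move=> m0 Am.
have fadd : finitely_additive (fun A => mu (residue_class i 8 `&` preimS 1 A)).
  move=> A1 A2 /residue_union_level[m1 _ l1] /residue_union_level[m2 _ l2] A12.
  rewrite preimSU setIUr; apply: hmu.1.
  - apply: (@level_residue_union m1.+1) => //; apply: levelI (level_preimS1 l1).
    exact: level_le (level_residue_class8 i).
  - apply: (@level_residue_union m2.+1) => //; apply: levelI (level_preimS1 l2).
    exact: level_le (level_residue_class8 i).
  apply/seteqP; split=> n // [[_ [_ n1]] [_ [_ n2]]].
  by have : (A1 `&` A2) (iter 1 collatz3 n) by []; rewrite A12.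
have gadd : finitely_additive (fun A => \sum_(l < 8)
    mu (residue_class i 8 `&` preimS 1 (residue_class l 8)) /
    mu (residue_class l 8) * mu (residue_class l 8 `&` A)).
  move=> A1 A2 /residue_union_level[m1 m10 l1] /residue_union_level[m2 m20 l2] A12.
  rewrite -big_split; apply: eq_bigr => l _ /=; rewrite -mulrDr setIUr hmu.1 //.
  - apply: (@level_residue_union m1) => //; apply: levelI l1.
    exact: level_le (level_residue_class8 l).
  - apply: (@level_residue_union m2) => //; apply: levelI l2.
    exact: level_le (level_residue_class8 l).
  by rewrite setIACA A12 setI0.
rewrite (finitely_additive_level fadd m0 Am) (finitely_additive_level gadd m0 Am).
apply: eq_bigr => c _.
have [N NE] := mu_transition_class i.
have c8 : (c %% 8 < 8)%N by rewrite ltn_mod.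
have d : (8 %| 8 ^ m)%N by rewrite dvdn_exp.
rewrite (bigD1 (Ordinal c8)) //= big1 => [|l lc]; last first.
  rewrite (_ : _ `&` residue_class c (8 ^ m) = set0).
    by rewrite (finitely_additive_set0 hmu.1) mulr0.
  apply/seteqP; split=> n // [/residue_class8P[_ nl]].
  move=> /(residue_classP _ (ltn_ord c))[_ nc]; case/eqP: lc; apply/val_inj => /=.
  by rewrite -nc (modn_dvdm _ d).
have -> : residue_class (c %% 8) 8 `&` residue_class c (8 ^ m) =
    residue_class c (8 ^ m).
  apply/seteqP; split=> [n []//|n nc]; split=> //.
  have [n0 nE] := (residue_classP _ (ltn_ord c)).1 nc.
  by apply/(residue_class8P (Ordinal c8)); rewrite /= -nE (modn_dvdm _ d).
rewrite NE // (NE 1%N _ isT c8) (mu_residue_class8 (Ordinal c8)) modn_mod hmu.2 //=.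
have -> : nu R (c %% 8) = nu R c.
  by rewrite /nu {2}(divn_eq c 8) oddD oddM andbF.
case: m m0 {Am d} c c8 => // m _ c c8; rewrite subn1 /= exprS.
by rewrite addr0 expr1 invfM -!mulrA mulKf ?nu_neq0.
Qed.

End InvariantMeasure.

Theorem proposition9 (R : realType) (mu_inv : set nat -> R)
  (hmu : is_mu_inv mu_inv) (k : nat) (hk : (0 < k)%N) (i j : 'I_8) :
  qk mu_inv k i j = (qstar mu_inv ^+ k) i j.
Proof.
case: k hk => // k _; elim: k i => [|k IH] i; first by rewrite expr1 !mxE.
have km := level_preimS k.+1 (level_residue_class8 j).
rewrite exprS mxE [RHS]mxE preimSS (mu_markov hmu i (ltn0Sn k.+1) km) // mulr_suml.
apply: eq_bigr => l _; rewrite -IH !mxE; ring.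
Qed.
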